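(* Let $\mathbb{K}$ be a field. There are, up to isomorphism, exactly $10$ square free monomial Cremona sets $F=\{f_1,\dots,f_6\}$ of degree $3$ in $\mathbb{K}[x_1,\dots,x_6]$ of type 3, i.e. whose log matrix $A_F$ has neither a row with five entries equal to $1$ nor a row with only one entry equal to $1$.
   Context: Let $F=\{f_1,\dots,f_n\}$ be a set of $n$ monomials of the same degree $d$ in $\mathbb{K}[x_1,\dots,x_n]$; write $f_j=x_1^{v_{1j}}\cdots x_n^{v_{nj}}$. The log matrix of $F$ is $A_F=(v_{ij})_{n\times n}$, so rows correspond to variables and columns to monomials. $F$ is square free if all $v_{ij}\in\{0,1\}$. $F$ is a Cremona set if the extension $\mathbb{K}[f_1,\dots,f_n]\subset \mathbb{K}[\underline{x}_d]$ becomes an equality on the level of fields of fractions, where $\mathbb{K}[\underline{x}_d]$ is the algebra generated by all monomials of degree $d$ in $x_1,\dots,x_n$ (equivalently, the rational map $\mathbb{P}^{n-1}\dashrightarrow\mathbb{P}^{n-1}$ given by $(f_1:\dots:f_n)$ is birational). Standing assumption (canonical restrictions): for each $j$ there is a $k$ with $x_j\mid f_k$ and there is a $k$ with $x_j\nmid f_k$. Two Cremona sets $F,F'$ are isomorphic if $F'=\sigma(F)$ (as unordered sets) for some $\sigma\in S_n$ acting by permutation of the variables. *)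

(* Defs.v *)
From HB Require Import structures.
From mathcomp Require Import all_boot all_order all_algebra all_fingroup.
From mathcomp Require Import fraction finmap.
From mathcomp Require Export mpoly.

Set Implicit Arguments.
Unset Strict Implicit.
Unset Printing Implicit Defensive.

Import GRing.Theory.
Local Open Scope fset_scope.
Local Open Scope ring_scope.

Section Subalgebra.
Variables (K : fieldType) (n : nat).

(* The K-subalgebra K[S] of K[x_1, ..., x_n]. *)
Inductive gen_alg (S : {mpoly K[n]} -> Prop) : {mpoly K[n]} -> Prop :=
| gen_alg_in p of S p : gen_alg S p
| gen_alg_const c : gen_alg S c%:MP
| gen_alg_add p q of gen_alg S p & gen_alg S q : gen_alg S (p + q)
| gen_alg_mul p q of gen_alg S p & gen_alg S q : gen_alg S (p * q).

(* The field of fractions of the domain A, inside K(x_1, ..., x_n). *)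
Definition frac_of (A : {mpoly K[n]} -> Prop) (z : {fraction {mpoly K[n]}}) :=
  exists p q : {mpoly K[n]},
    [/\ A p, A q, q != 0 & z = FracField.tofrac p / FracField.tofrac q].

End Subalgebra.

Section MonomialSets.
Variable n : nat.
Implicit Types (F : {fset 'X_{1..n}}) (s : 'S_n) (m : 'X_{1..n}).

Definition same_degree d F := forall m, m \in F -> mdeg m = d.

(* The monomials are listed in the enumeration order of the finite set F; this
   order is immaterial for all uses below, which only count entries in a row. *)
Definition log_matrix F : 'M[nat]_n :=
  \matrix_(i < n, j < n) (nth 0%MM (enum_fset F) j) i.

Definition square_free F := forall m i, m \in F -> (m i <= 1)%N.

Definition canonical_restrictions F :=
  forall i : 'I_n, (exists2 m, m \in F & (0 < m i)%N) /\
                   (exists2 m, m \in F & m i = 0%N).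

Definition cremona (K : fieldType) d F :=
  [/\ #|` F| = n, same_degree d F &
    forall z : {fraction {mpoly K[n]}},
      frac_of (gen_alg (fun p => exists2 m, m \in F & p = 'X_[K, m])) z <->
      frac_of (gen_alg (fun p => exists2 m, mdeg m = d & p = 'X_[K, m])) z].

(* The image of a monomial under the substitution x_i |-> x_(s i). *)
Definition perm_monomial s m : 'X_{1..n} := [multinom m ((s^-1)%g i) | i < n].

Definition monomial_iso F F' :=
  exists s : 'S_n, F' = [fset perm_monomial s m | m in F].

Definition ones_in_row (A : 'M[nat]_n) (i : 'I_n) : nat :=
  #|[set j | A i j == 1%N]|.

End MonomialSets.

Definition type3 (F : {fset 'X_{1..6}}) :=
  forall i : 'I_6, ones_in_row (log_matrix F) i != 5%N /\
                   ones_in_row (log_matrix F) i != 1%N.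

Definition type3_cremona (K : fieldType) (F : {fset 'X_{1..6}}) :=
  [/\ cremona K 3%N F, square_free F, canonical_restrictions F & type3 F].

(* Main.v *)
(* Let L be the lattice spanned by the exponent vectors of F. A monomial that is
   a quotient of elements of K[F] has its exponent in L, so F is a Cremona set
   iff L contains every difference e_i - e_j. If it does not, then Z^6 / L has a
   character that kills F but not all monomials of degree 3; for type 3 sets,
   characters of order 2 and 9 are enough. The classification is then an
   exhaustive search among the 6-element subsets of the 20 square free monomials
   of degree 3: each of them lies in the S_6-orbit of a model, is killed by such
   a character, or is not of type 3. *)
Require Import Defs.
From mathcomp Require Import all_boot all_order all_algebra finmap.
From mathcomp Require Import fraction perm.

Set Implicit Arguments.
Unset Strict Implicit.
Unset Printing Implicit Defensive.

Import GRing.Theory.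

(** * The lattice criterion for Cremona sets *)

Section Lattice.
Local Open Scope ring_scope.
Variables (K : fieldType) (n : nat).
Implicit Types (F : {fset 'X_{1..n}}) (m u v : 'X_{1..n}) (p q : {mpoly K[n]}).

Local Notation tf := (@FracField.tofrac {mpoly K[n]}).

(** Constants have exponent 0, sums create no new exponents, and products only add exponents; so a
    submonoid that contains the exponents of the generators contains those of the whole algebra. It
    is applied to the exponents of weight 0. *)
Lemma gen_alg_msupp (S : {mpoly K[n]} -> Prop) (P : 'X_{1..n} -> Prop) :
    P 0%MM -> (forall u v, P u -> P v -> P (u + v)%MM) ->
    (forall p, S p -> forall m, m \in msupp p -> P m) ->
  forall p, gen_alg S p -> forall m, m \in msupp p -> P m.
Proof.
move=> P0 PD PS p; elim=> {p} [p /PS //|c|p q _ IHp _ IHq|p q _ IHp _ IHq] m.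
- by rewrite msuppC; case: ifP => // _; rewrite inE => /eqP ->.
- by move/msuppD_le; rewrite mem_cat => /orP[/IHp|/IHq].
- by move/msuppM_le/allpairsP => [[u v] /= [/IHp Pu /IHq Pv ->]]; apply: PD.
Qed.

Lemma frac_of_monomial (A : {mpoly K[n]} -> Prop) p :
  A 1 -> A p -> frac_of A (tf p).
Proof.
by move=> A1 Ap; exists p, 1; split; rewrite ?oner_neq0 // rmorph1 divr1.
Qed.

Lemma gen_alg1 (S : {mpoly K[n]} -> Prop) : gen_alg S 1.
Proof. by rewrite -mpolyC1; apply: gen_alg_const. Qed.

(* Grade K[x] by Z/k, giving x_i the weight w_i: if F has weight 0, so do all
   elements of K[F]; a monomial that is a quotient of two of them then has
   weight 0 as well. *)
Lemma cremona_weight F d k (w : 'I_n -> nat) : cremona K d F ->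
    (forall m, m \in F -> (k %| \sum_i w i * m i)%N) ->
  forall m, mdeg m = d -> (k %| \sum_i w i * m i)%N.
Proof.
move=> [_ _ CF] wF m md.
have /CF[p [q [Ap Aq q0 /eqP]]] : frac_of
    (gen_alg (fun p => exists2 m, mdeg m = d & p = 'X_[K, m])) (tf 'X_[m]).
  by apply: frac_of_monomial; [apply: gen_alg1 | apply: gen_alg_in; exists m].
have tq0 : tf q != 0 by rewrite tofrac_eq0.
rewrite eq_sym -(inj_eq (mulIf tq0)) divfK // -rmorphM /= tofrac_eq => /eqP pE.
pose P u := (k %| \sum_i w i * u i)%N.
have P0 : P 0%MM by rewrite /P big1 // => i _; rewrite mnm0E muln0.
have PE u v : (\sum_i w i * (u + v)%MM i =
    \sum_i w i * u i + \sum_i w i * v i)%N.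
  by rewrite -big_split; apply: eq_bigr => i _; rewrite mnmDE mulnDr.
have PA r : gen_alg (fun p => exists2 m, m \in F & p = 'X_[K, m]) r ->
    forall u, u \in msupp r -> P u.
  apply: gen_alg_msupp => // [u v Pu Pv|_ [u uF ->] v].
    by rewrite /P PE dvdn_addr.
  by rewrite msuppX inE => /eqP ->; apply: wF.
have [u uq] : exists u, u \in msupp q.
  by exists (mlead q); rewrite mlead_supp.
(* Clearing the denominator gave p = X^m q, so the exponent u of q is shifted to an exponent m + u
   of p. *)
have : P (m + u)%MM.
  apply: (PA p) => //; rewrite pE mulrC.
  by rewrite (perm_mem (msuppMX _ _)); apply/mapP; exists u.
by rewrite /P PE dvdn_addl //; apply: PA uq.
Qed.

(* u - v lies in the lattice spanned by F; both signs are moved to the positive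
   side. *)
Definition same_class F u v := exists a b : seq 'X_{1..n},
  [/\ {subset a <= F}, {subset b <= F} &
      (u + \sum_(f <- b) f = v + \sum_(f <- a) f)%MM].

Lemma mnm_sum_cat (a b : seq 'X_{1..n}) :
  (\sum_(f <- a ++ b) f = \sum_(f <- a) f + \sum_(f <- b) f)%MM.
Proof. exact: big_cat. Qed.

Lemma same_class_refl F u : same_class F u u.
Proof. by exists [::], [::]. Qed.

Lemma same_class_sym F u v : same_class F u v -> same_class F v u.
Proof. by case=> a [b [aF bF e]]; exists b, a. Qed.

Lemma same_class_trans F u v m :
  same_class F u v -> same_class F v m -> same_class F u m.
Proof.
move=> [a [b [aF bF e]]] [a' [b' [aF' bF' e']]].
exists (a ++ a'), (b ++ b').
split; try by move=> x; rewrite mem_cat => /orP[]; auto.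
by rewrite !mnm_sum_cat addmA e Monoid.mulmAC /= e' -addmA
  [X in (m + X)%MM]addmC.
Qed.

Lemma same_classD F u v u' v' : same_class F u v -> same_class F u' v' ->
  same_class F (u + u')%MM (v + v')%MM.
Proof.
move=> [a [b [aF bF e]]] [a' [b' [aF' bF' e']]].
exists (a ++ a'), (b ++ b').
split; try by move=> x; rewrite mem_cat => /orP[]; auto.
by rewrite !mnm_sum_cat Monoid.mulmACA /= e e' Monoid.mulmACA.
Qed.

(** Replacing each variable of u by x_i0 does not change its class, so u is equivalent to x_i0^(deg
    u), which depends on the degree only. *)
Lemma same_class_mdeg F i0 m m' : (forall i, same_class F U_(i)%MM U_(i0)%MM) ->
  mdeg m = mdeg m' -> same_class F m m'.
Proof.
move=> Fi.
have to_i0 u : same_class F u (U_(i0) *+ mdeg u)%MM.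
  rewrite {1}[u]multinomUE_id.
  have -> : (U_(i0) *+ mdeg u = \sum_i U_(i0) *+ u i)%MM.
    apply/mnmP => j; rewrite mnm_sumE mulmnE mdegE big_distrr /=.
    by apply: eq_bigr => i _; rewrite mulmnE.
  apply: (big_ind2 (same_class F)) => [|u1 v1 u2 v2|i _].
  - exact: same_class_refl.
  - exact: same_classD.
  elim: (u i) => [|k IHk]; first exact: same_class_refl.
  by rewrite !mulmS; apply: same_classD.
move=> mm'; apply: same_class_trans (to_i0 m) _.
by rewrite mm'; apply: same_class_sym.
Qed.

Lemma gen_alg_monomials F (a : seq 'X_{1..n}) : {subset a <= F} ->
  gen_alg (fun p => exists2 m, m \in F & p = 'X_[K, m]) 'X_[\sum_(f <- a) f].
Proof.
rewrite -mpolyX_prod; elim: a => [|f a IHa] aF.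
  by rewrite big_nil; apply: gen_alg1.
rewrite big_cons; apply: gen_alg_mul.
  by apply: gen_alg_in; exists f; rewrite ?aF ?mem_head.
by apply: IHa => g ga; rewrite aF // inE ga orbT.
Qed.

Section FracOf.
Variable S : {mpoly K[n]} -> Prop.

Lemma frac_ofD y z : frac_of (gen_alg S) y -> frac_of (gen_alg S) z ->
  frac_of (gen_alg S) (y + z).
Proof.
move=> [p [q [Ap Aq q0 ->]]] [p' [q' [Ap' Aq' q0' ->]]].
exists (p * q' + p' * q), (q * q'); split; rewrite ?mulf_neq0 //.
- by apply: gen_alg_add; apply: gen_alg_mul.
- exact: gen_alg_mul.
by rewrite rmorphD !rmorphM /= addf_div // tofrac_eq0.
Qed.

Lemma frac_ofM y z : frac_of (gen_alg S) y -> frac_of (gen_alg S) z ->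
  frac_of (gen_alg S) (y * z).
Proof.
move=> [p [q [Ap Aq q0 ->]]] [p' [q' [Ap' Aq' q0' ->]]].
exists (p * p'), (q * q'); split; rewrite ?mulf_neq0 //; try exact: gen_alg_mul.
by rewrite !rmorphM /= mulf_div.
Qed.

Lemma frac_ofV z : frac_of (gen_alg S) z -> frac_of (gen_alg S) z^-1.
Proof.
(* The inverse of 0 is 0 by convention, so p = 0 is treated apart. *)
move=> [p [q [Ap Aq q0 ->]]]; have [->|p0] := eqVneq p 0.
  by exists 0, 1; rewrite !rmorph0 !mul0r invr0 -mpolyC0 oner_neq0;
     split=> //; [apply: gen_alg_const | apply: gen_alg1].
by exists q, p; rewrite invf_div.
Qed.

(** The fractions of K[S] form a field containing K; once it contains S', it contains K[S'] and the
    quotients of its elements. *)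
Lemma frac_of_gen_alg (S' : {mpoly K[n]} -> Prop) :
    (forall p, S' p -> frac_of (gen_alg S) (tf p)) ->
  forall z, frac_of (gen_alg S') z -> frac_of (gen_alg S) z.
Proof.
move=> SS'; have tfA p : gen_alg S' p -> frac_of (gen_alg S) (tf p).
  elim=> {p} [p /SS' //|c|p q _ IHp _ IHq|p q _ IHp _ IHq].
  - by apply: frac_of_monomial; [apply: gen_alg1 | apply: gen_alg_const].
  - by rewrite rmorphD; apply: frac_ofD.
  - by rewrite rmorphM; apply: frac_ofM.
move=> _ [p [q [Ap Aq _ ->]]].
exact: frac_ofM (tfA _ Ap) (frac_ofV (tfA _ Aq)).
Qed.
End FracOf.

Lemma cremona_same_class F d i0 :
    #|` F| = n -> same_degree d F ->
    (forall i, same_class F U_(i)%MM U_(i0)%MM) ->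
  cremona K d F.
Proof.
move=> cF dF Fi; split=> // z; have [f fF] : exists f, f \in F.
  by apply/fset0Pn; rewrite -cardfs_gt0 cF (leq_ltn_trans _ (ltn_ord i0)).
split; apply: frac_of_gen_alg.
  move=> _ [m mF ->]; apply: frac_of_monomial; first exact: gen_alg1.
  by apply: gen_alg_in; exists m; rewrite ?dF.
move=> _ [m md ->].
have [|a [b [aF bF e]]] := @same_class_mdeg F i0 m f Fi; first by rewrite md dF.
(* Since m and f have the same degree, m + sum b = f + sum a with a and b in F; this writes X^m as a
   quotient of two products of elements of F. *)
exists 'X_[f + \sum_(g <- a) g], 'X_[\sum_(g <- b) g].
have X0 u : 'X_[K, u] != 0 by rewrite -msupp_eq0 msuppX.
split=> //; last first.
- by rewrite -e mpolyXD rmorphM mulfK // tofrac_eq0.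
- exact: gen_alg_monomials.
rewrite mpolyXD; apply: gen_alg_mul; last exact: gen_alg_monomials.
by apply: gen_alg_in; exists f.
Qed.
End Lattice.

(** * Square free monomials as bit words *)

Section Monomials.
Variable n : nat.
Implicit Types (t : bitseq) (g : seq bitseq) (m : 'X_{1..n}) (p : seq nat).

Fixpoint bitvecs k : seq bitseq :=
  if k is k'.+1 then [seq b :: v | b <- [:: true; false], v <- bitvecs k']
  else [:: [::]].

Lemma mem_bitvecs k t : (t \in bitvecs k) = (size t == k).
Proof.
elim: k t => [|k IHk] t; first by case: t.
apply/allpairsP/idP => [[[b v] [_ /= vk ->]]|]; first by rewrite /= eqSS -IHk.
case: t => // b v; rewrite /= eqSS -IHk => vk.
by exists (b, v); split=> //; case: b.
Qed.

Lemma bitvecs_uniq k : uniq (bitvecs k).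
Proof.
by elim: k => [|k IHk] //; apply: allpairs_uniq => // -[? ?] [? ?] _ _ [-> ->].
Qed.

Definition expo t : 'X_{1..n} := [multinom nat_of_bool (nth false t i) | i < n].

Definition monos g : {fset 'X_{1..n}} := [fset expo t | t in g]%fset.

(** The length is fixed because [expo] pads short words with [false] and ignores letters beyond
    n. *)
Lemma expo_inj : {in [pred t | size t == n] &, injective expo}.
Proof.
move=> s t /eqP sn /eqP tn /mnmP st.
apply: (@eq_from_nth _ false) => [|i]; rewrite sn ?tn // => i_n.
by have := st (Ordinal i_n); rewrite !mnmE; do 2!case: nth.
Qed.

Lemma expoK m : (forall i, m i <= 1) ->
  expo [seq m i != 0 | i <- enum 'I_n] = m.
Proof.
move=> m1; apply/mnmP => i; rewrite mnmE (nth_map i) ?size_enum_ord //.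
by rewrite nth_ord_enum; case: (m i) (m1 i) => [|[]].
Qed.

Lemma mdeg_expo t : size t = n -> mdeg (expo t) = count id t.
Proof.
move=> tn; rewrite mdegE -sum1_count.
rewrite [RHS]big_mkcond (big_nth false) tn big_mkord.
by apply: eq_bigr => i _; rewrite mnmE; case: nth.
Qed.

Lemma mem_monos g t : {subset g <= [pred t | size t == n]} -> size t == n ->
  (expo t \in monos g) = (t \in g).
Proof.
move=> gn tn; apply/imfsetP/idP => [[s /= sg /expo_inj -> //]|tg].
  exact: gn.
by exists t.
Qed.

Lemma perm_monos g : uniq g -> {subset g <= [pred t | size t == n]} ->
  perm_eq (enum_fset (monos g)) (map expo g).
Proof.
move=> ug gn; apply: uniq_perm; rewrite ?fset_uniq //.
  by rewrite map_inj_in_uniq // => s t /gn sn /gn tn; apply: expo_inj.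
by move=> m; apply/imfsetP/mapP => -[t tg ->]; exists t.
Qed.

Lemma eq_monos g g' : g =i g' -> monos g = monos g'.
Proof. by move=> gg'; apply/fsetP => m; apply/imfsetP/imfsetP => -[t tg ->];
  exists t; rewrite //= ?gg' // -gg'. Qed.

Definition permute p t : bitseq := [seq nth false t i | i <- p].

(** The inverse matches [perm_monomial]: position i of the new word reads position s^-1 i of the old
    one. *)
Definition perm_word (s : 'S_n) : seq nat :=
  [seq val ((s^-1)%g i) | i <- enum 'I_n].

Lemma size_perm_word s : size (perm_word s) = n.
Proof. by rewrite size_map size_enum_ord. Qed.

(** This lets a computation run through S_n as [permutations (iota 0 n)]. *)
Lemma perm_wordP p : reflect (exists s, p = perm_word s) (perm_eq p (iota 0 n)).
Proof.
apply: (iffP idP) => [pn|[s ->]]; last first.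
  apply: uniq_perm; rewrite ?iota_uniq //.
    by rewrite map_inj_uniq ?enum_uniq // => i j /val_inj /perm_inj.
  move=> k; rewrite mem_iota /= add0n; apply/mapP/idP => [[i _ ->]|kn].
    exact: ltn_ord.
  by exists (s (Ordinal kn)); rewrite ?mem_enum // permK.
have sp : size p = n by rewrite (perm_size pn) size_iota.
have p_lt (i : 'I_n) : nth 0 p i < n.
  have : nth 0 p i \in iota 0 n by rewrite -(perm_mem pn) mem_nth ?sp.
  by rewrite mem_iota.
have f_inj : injective (fun i => Ordinal (p_lt i)).
  move=> i j [] /eqP; rewrite nth_uniq ?sp ?(perm_uniq pn) ?iota_uniq //.
  by move/eqP/val_inj.
(* The inverse cancels the one inside [perm_word]. *)
exists ((perm f_inj)^-1)%g; apply: (@eq_from_nth _ 0).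
  by rewrite size_map size_enum_ord.
move=> i; rewrite sp => i_n.
by rewrite (nth_map (Ordinal i_n)) ?size_enum_ord // invgK permE /=
  nth_enum_ord.
Qed.

Lemma expo_permute s t :
  perm_monomial s (expo t) = expo (permute (perm_word s) t).
Proof.
apply/mnmP => i; rewrite !mnmE /permute /perm_word -map_comp.
by rewrite (nth_map i) ?size_enum_ord //= nth_ord_enum.
Qed.

Lemma monomial_isoP g g' :
    {subset g <= [pred t | size t == n]} ->
    {subset g' <= [pred t | size t == n]} ->
  monomial_iso (monos g) (monos g') <->
  exists2 p, p \in permutations (iota 0 n) & map (permute p) g =i g'.
Proof.
move=> gn g'n.
have imE s : [fset perm_monomial s m | m in monos g]%fset =
    monos (map (permute (perm_word s)) g).
  apply/fsetP => m; apply/imfsetP/imfsetP => [[_ /imfsetP[t /= tg ->] ->]|].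
    by exists (permute (perm_word s) t); rewrite ?expo_permute //= map_f.
  move=> [_ /mapP[t tg ->] ->]; exists (expo t); rewrite ?expo_permute //.
  by apply/imfsetP; exists t.
split=> [[s]|[p]]; last first.
  rewrite mem_permutations => /perm_wordP[s ->] gg'.
  by exists s; rewrite imE; apply: eq_monos => t; rewrite gg'.
rewrite imE => gg'; exists (perm_word s).
  by rewrite mem_permutations; apply/perm_wordP; exists s.
have pgn : {subset map (permute (perm_word s)) g <= [pred t | size t == n]}.
  by move=> _ /mapP[t _ ->]; rewrite inE size_map size_perm_word.
(* Words of length n are determined by their monomials; words of any other length lie in neither
   list. *)
move=> t; have [tn|tn] := boolP (size t == n).
  by rewrite -!mem_monos // gg'.
by rewrite (contraNF (@pgn t)) ?(contraNF (@g'n t)).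
Qed.

Lemma ones_in_rowE (F : {fset 'X_{1..n}}) i : #|` F|%fset = n ->
  ones_in_row (log_matrix F) i = count (fun m => m i == 1) (enum_fset F).
Proof.
move=> Fn; rewrite /ones_in_row cardsE -sum1_card -sum1_count (big_nth 0%MM).
rewrite -[size _]/(#|` F|%fset) Fn big_mkord.
by apply: eq_bigl => j; rewrite unfold_in /= mxE.
Qed.

Lemma ones_in_row_monos g i :
    uniq g -> {subset g <= [pred t | size t == n]} -> size g = n ->
  ones_in_row (log_matrix (monos g)) i = count (nth false ^~ i) g.
Proof.
move=> ug gn sg; have pg := perm_monos ug gn.
rewrite ones_in_rowE; last by rewrite (perm_size pg) size_map.
rewrite (seq.permP pg) count_map; apply: eq_count => t /=.
by rewrite mnmE; case: nth.
Qed.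

(** The left side is the weight of a square free monomial in the form used by computations, the
    right side the form used by [cremona_weight]. *)
Lemma sumn_mask t (w : seq nat) :
  sumn (mask t w) = \sum_(i < size t) nth 0 w i * nth false t i.
Proof.
elim: t w => [|b t IHt] [|a w]; rewrite ?big_ord0 //=.
  by rewrite big1 // => i _; rewrite nth_nil.
by rewrite big_ord_recl /= -IHt; case: b; rewrite ?muln1 ?muln0.
Qed.

End Monomials.

(** * Exhaustive search among subsets of a given size *)

Definition starting (x : bool) (cs : seq bitseq) : seq bitseq :=
  pmap (fun c => if c is y :: c' then if eqb y x then Some c' else None
                 else None) cs.

Lemma mem_starting x c cs : (c \in starting x cs) = (x :: c \in cs).
Proof.
elim: cs => // -[|y d] cs IHcs /=; rewrite ?inE //.
by case: y x IHcs => [] [] IHcs; rewrite /= ?inE IHcs.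
Qed.

Section Covered.
Variables (T : Type) (ok : seq T -> bool).
Implicit Types (ts acc : seq T) (b : bitseq) (cs os : seq bitseq).

(* A subset of ts is encoded by its indicator word. Both lists of words are
   filtered along the search: at a leaf, cs contains the empty word iff the
   chosen subset was listed, and os is nonempty iff that subset lies below one
   of the words of os. *)
Fixpoint covered (k : nat) ts acc cs os : bool :=
  if ts is t :: ts' then
    covered k ts' acc (starting false cs) (map behead os) &&
    (if k is k'.+1 then
       covered k' ts' (t :: acc) (starting true cs) (starting true os)
     else true)
  else [|| 0 < k, has (fun c => nilp c) cs, 0 < size os | ok acc].

(** Induction along [b], one element per letter. A skipped element puts no condition on the words of
    [os], a chosen one keeps only the words that contain it; the survivors at a leaf lie above
    [b]. *)
Lemma coveredP k ts acc cs os b : covered k ts acc cs os ->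
    size b = size ts -> count id b = k ->
  [|| b \in cs, has (fun o => all id (mask b o)) os |
      ok (catrev (mask b ts) acc)].
Proof.
elim: ts k acc cs os b => [|t ts IHts] k acc cs os [|[] b] //=.
- case: k => // /or4P[//|/hasP[[] //]||->]; rewrite ?orbT //.
    by move=> ->.
  by case: os => //= o os _; rewrite orbT.
- case: k => // k /andP[_ cov] [sb] [cb].
  case/or3P: (IHts _ _ _ _ _ cov sb cb) => [||->]; rewrite ?orbT //.
    by rewrite mem_starting => ->.
  case/hasP => o; rewrite mem_starting => os_o bo.
  by apply/or3P/Or32/hasP; exists (true :: o).
- move=> /andP[cov _] [sb] cb.
  case/or3P: (IHts _ _ _ _ _ cov sb cb) => [||->]; rewrite ?orbT //.
    by rewrite mem_starting => ->.
  case/hasP => _ /mapP[o os_o ->] bo.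
  apply/or3P/Or32/hasP; exists o => //.
  by case: o bo {os_o} => //=; rewrite mask0s.
Qed.
End Covered.

(** * Orbits, type and gradings for cubic monomials in six variables *)

Implicit Types (t : bitseq) (g : seq bitseq).

Definition triples : seq bitseq := [seq t <- bitvecs 6 | count id t == 3].
Arguments triples : simpl never.

Lemma mem_triples t : (t \in triples) = (size t == 6) && (count id t == 3).
Proof. by rewrite mem_filter mem_bitvecs andbC. Qed.

Lemma triples_uniq : uniq triples.
Proof. by rewrite filter_uniq ?bitvecs_uniq. Qed.

Lemma size_triples g : {subset g <= triples} ->
  {subset g <= [pred t | size t == 6]}.
Proof. by move=> gT t /gT; rewrite mem_triples => /andP[]. Qed.

(** As the order of [triples] is fixed, equality of sets becomes equality of words, and these are
    the words that the search reads. *)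
Definition code (g : seq bitseq) : bitseq := [seq t \in g | t <- triples].

Lemma code_inj g g' : {subset g <= triples} -> {subset g' <= triples} ->
  code g = code g' <-> g =i g'.
Proof.
move=> gT g'T; split=> [/eq_in_map gg' t|gg']; last exact: eq_map.
have [tT|tT] := boolP (t \in triples); first exact: gg'.
by rewrite (contraNF (@gT t)) ?(contraNF (@g'T t)).
Qed.

Definition codes (g : seq bitseq) : seq bitseq :=
  [seq code (map (permute p) g) | p <- permutations (iota 0 6)].

Lemma codesP g g' : {subset g <= triples} -> {subset g' <= triples} ->
  code g' \in codes g <-> monomial_iso (monos 6 g) (monos 6 g').
Proof.
move=> gT g'T; rewrite monomial_isoP; try exact: size_triples.
have pT p : p \in permutations (iota 0 6) ->
    {subset map (permute p) g <= triples}.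
  rewrite mem_permutations => pn _ /mapP[t /gT + ->].
  rewrite !mem_triples => /andP[/eqP t6 t3].
  (* Permuting the letters keeps the length and the number of ones, so triples go to triples. *)
  have pt : perm_eq (permute p t) t.
    by rewrite -[t in perm_eq _ t](mkseq_nth false) t6; apply: perm_map.
  by rewrite (perm_size pt) t6 (seq.permP pt).
split=> [/mapP[p pn /esym]|[p pn pgg']].
  by move/(code_inj (pT p pn) g'T) => pgg'; exists p.
by apply/mapP; exists p => //; apply/esym/code_inj => //; apply: pT.
Qed.

Definition type3b (g : seq bitseq) : bool :=
  all (fun i => let c := count (nth false ^~ i) g in (c != 5) && (c != 1))
    (iota 0 6).

Lemma type3P g : uniq g -> {subset g <= triples} -> size g = 6 ->
  reflect (type3 (monos 6 g)) (type3b g).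
Proof.
move=> ug gT g6; apply: (iffP allP) => [gi i|gi i].
  rewrite ones_in_row_monos //; last exact: size_triples.
  by have := gi i; rewrite mem_iota ltn_ord => /(_ isT)/andP.
rewrite mem_iota /= add0n => i6; have := gi (Ordinal i6).
rewrite ones_in_row_monos //; last exact: size_triples.
by move=> /andP.
Qed.

(* A pair (k, w) stands for the Z/k-grading in which x_i has weight w_i. When
   the log matrix has even determinant, a grading mod 2 gives weight 0 to F; the
   gradings mod 9 are for the orbit of sets with determinant 9, for which F_2
   and F_3 do not suffice. *)
Definition gradings : seq (nat * seq nat) :=
  [seq (2, map nat_of_bool v) | v <- bitvecs 6] ++
  [seq (9, w) | w <- permutations [:: 1; 1; 4; 4; 7; 7]].

(** For each grading mod 9 the kernel has exactly six triples, two of each weight pattern 1+1+7,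
    1+4+4 and 4+7+7. *)
Definition kernel_code (kw : nat * seq nat) : bitseq :=
  [seq kw.1 %| sumn (mask t kw.2) | t <- triples].

(** The filter discards the zero weight mod 2, the only grading in the list that kills all
    triples. *)
Definition obstructions : seq bitseq :=
  [seq c <- map kernel_code gradings | ~~ all id c].

Lemma cremona_grading (K : fieldType) g (kw : nat * seq nat) :
    {subset g <= triples} -> cremona K 3 (monos 6 g) ->
    all (fun t => kw.1 %| sumn (mask t kw.2)) g ->
  all id (kernel_code kw).
Proof.
move=> gT Cg /allP gw; rewrite all_map; apply/allP => t tT /=.
have wE s : s \in triples ->
    sumn (mask s kw.2) = \sum_(i < 6) nth 0 kw.2 i * expo 6 s i.
  rewrite mem_triples sumn_mask => /andP[/eqP -> _].
  by apply: eq_bigr => i _; rewrite mnmE.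
rewrite wE //; apply: (cremona_weight Cg (w := fun i : 'I_6 => nth 0 kw.2 i)).
  by move=> _ /imfsetP[s /= sg ->]; rewrite -wE ?gT ?gw.
by move: tT; rewrite mem_triples => /andP[/eqP t6 /eqP t3]; rewrite mdeg_expo.
Qed.

Lemma monos_triples (F : {fset 'X_{1..6}}) : square_free F -> same_degree 3 F ->
  monos 6 [seq t <- triples | expo 6 t \in F] = F.
Proof.
move=> F1 F3; apply/fsetP => m; apply/imfsetP/idP => [[t + ->]|mF].
  by rewrite mem_filter => /andP[tF _]; exact: tF.
have mE : expo 6 [seq m i != 0 | i <- enum 'I_6] = m.
  by apply: expoK => i; apply: F1.
set t := [seq _ | i <- _] in mE.
have t6 : size t = 6 by rewrite size_map size_enum_ord.
exists t; last by rewrite mE.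
by rewrite mem_filter mE mF mem_triples t6 -(mdeg_expo t6) mE F3.
Qed.

(** * The ten models and their certificates *)

(* Each entry lists the supports of f_0, ..., f_5, and for i = 1, ..., 5 index
   lists a, b such that x_i * \prod_(j <- b) f_j = x_0 * \prod_(j <- a) f_j. *)
Definition models : seq (seq (seq nat) * seq (seq nat * seq nat)) :=
[::
  ([:: [:: 0; 1; 2]; [:: 0; 1; 3]; [:: 0; 1; 4];
       [:: 0; 2; 5]; [:: 1; 2; 5]; [:: 3; 4; 5]],
   [:: ([:: 4], [:: 3]); ([:: 0; 0; 5], [:: 1; 2; 3]); ([:: 0; 5], [:: 2; 3]);
       ([:: 0; 5], [:: 1; 3]); ([:: 4], [:: 0])]);
  ([:: [:: 0; 1; 2]; [:: 0; 1; 3]; [:: 0; 1; 4];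
       [:: 0; 2; 5]; [:: 1; 3; 5]; [:: 2; 4; 5]],
   [:: ([:: 0; 4], [:: 1; 3]); ([:: 0; 5], [:: 2; 3]); ([:: 1; 5], [:: 2; 3]);
       ([:: 5], [:: 3]); ([:: 4], [:: 1])]);
  ([:: [:: 0; 1; 2]; [:: 0; 1; 3]; [:: 0; 1; 4];
       [:: 0; 2; 5]; [:: 2; 3; 4]; [:: 2; 3; 5]],
   [:: ([:: 0; 2; 5; 5], [:: 1; 3; 3; 4]); ([:: 0; 5], [:: 1; 3]); ([:: 5], [:: 3]);
       ([:: 2; 5], [:: 1; 3]); ([:: 2; 5; 5], [:: 1; 3; 4])]);
  ([:: [:: 0; 1; 2]; [:: 0; 1; 3]; [:: 0; 1; 4];
       [:: 0; 2; 5]; [:: 2; 3; 4]; [:: 3; 4; 5]],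
   [:: ([:: 0; 0; 0; 5; 5], [:: 1; 2; 3; 3; 4]); ([:: 0; 0; 5], [:: 1; 2; 3]);
       ([:: 0; 5], [:: 2; 3]); ([:: 0; 5], [:: 1; 3]); ([:: 0; 0; 5; 5], [:: 1; 2; 3; 4])]);
  ([:: [:: 0; 1; 2]; [:: 0; 1; 3]; [:: 0; 2; 3];
       [:: 0; 4; 5]; [:: 1; 2; 4]; [:: 1; 4; 5]],
   [:: ([:: 5], [:: 3]); ([:: 2; 5], [:: 1; 3]); ([:: 2; 5], [:: 0; 3]);
       ([:: 4], [:: 0]); ([:: 2; 5; 5], [:: 1; 3; 4])]);
  ([:: [:: 0; 1; 2]; [:: 0; 1; 3]; [:: 0; 2; 3];
       [:: 0; 4; 5]; [:: 1; 2; 4]; [:: 3; 4; 5]],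
   [:: ([:: 0; 5], [:: 2; 3]); ([:: 0; 5], [:: 1; 3]); ([:: 5], [:: 3]);
       ([:: 4], [:: 0]); ([:: 0; 0; 5; 5], [:: 1; 2; 3; 4])]);
  ([:: [:: 0; 1; 2]; [:: 0; 1; 3]; [:: 0; 2; 3];
       [:: 1; 2; 4]; [:: 1; 3; 5]; [:: 2; 4; 5]],
   [:: ([:: 3; 4], [:: 1; 5]); ([:: 2; 3; 4], [:: 1; 1; 5]); ([:: 2; 3; 4], [:: 0; 1; 5]);
       ([:: 3], [:: 0]); ([:: 4], [:: 1])]);
  ([:: [:: 0; 1; 2]; [:: 0; 1; 3]; [:: 0; 2; 4];
       [:: 0; 3; 5]; [:: 1; 2; 5]; [:: 1; 4; 5]],
   [:: ([:: 1; 4], [:: 0; 3]); ([:: 1; 2; 4; 4], [:: 0; 0; 3; 5]);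
       ([:: 1; 1; 2; 4; 4], [:: 0; 0; 0; 3; 5]);
       ([:: 1; 2; 4], [:: 0; 0; 3]); ([:: 4], [:: 0])]);
  ([:: [:: 0; 1; 2]; [:: 0; 1; 3]; [:: 0; 2; 4];
       [:: 0; 3; 5]; [:: 1; 4; 5]; [:: 2; 4; 5]],
   [:: ([:: 1; 5], [:: 2; 3]); ([:: 1; 5; 5], [:: 2; 3; 4]);
       ([:: 1; 1; 5; 5], [:: 0; 2; 3; 4]); ([:: 1; 5], [:: 0; 3]); ([:: 5], [:: 2])]);
  ([:: [:: 0; 1; 2]; [:: 0; 1; 3]; [:: 0; 2; 4];
       [:: 0; 3; 5]; [:: 2; 3; 4]; [:: 3; 4; 5]],
   [:: ([:: 0; 5], [:: 2; 3]); ([:: 0; 4], [:: 1; 2]); ([:: 4], [:: 2]);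
       ([:: 5], [:: 3]); ([:: 0; 5], [:: 1; 2])])].

Definition model_set (M : seq (seq nat) * seq (seq nat * seq nat)) :
    seq bitseq :=
  [seq [seq i \in s | i <- iota 0 6] | s <- M.1].

Definition reps : seq (seq bitseq) := map model_set models.

(** The identity is compared exponent by exponent. The bound on the indices rules out the default
    word of [nth], which would stand for the monomial 1. *)
Definition check_certificate g i (ab : seq nat * seq nat) : bool :=
  all (fun j => j < size g) (ab.1 ++ ab.2) &&
  all (fun k =>
      let exponent a := sumn [seq nat_of_bool (nth false (nth [::] g j) k) | j <- a] in
      (i == k) + exponent ab.2 == (0 == k) + exponent ab.1)
    (iota 0 6).

(** [M.2] starts at i = 1; the empty pair put in front is the trivial certificate for x_0. *)
Definition check_model M : bool :=
  let g := model_set M in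
  [&& uniq g, all (fun t => t \in triples) g, size g == 6, type3b g,
      all (fun i => has (nth false ^~ i) g && ~~ all (nth false ^~ i) g)
        (iota 0 6) &
      all (fun i => check_certificate g i (nth ([::], [::]) (([::], [::]) :: M.2) i))
        (iota 0 6)].

Lemma check_certificateP g (i : 'I_6) ab : check_certificate g i ab ->
  same_class (monos 6 g) U_(i)%MM U_(ord0)%MM.
Proof.
move=> /andP[/allP lt_g /allP e].
pose f j := expo 6 (nth [::] g j).
have fF a : {subset a <= ab.1 ++ ab.2} -> {subset map f a <= monos 6 g}.
  move=> sub _ /mapP[j /sub/lt_g j_g ->]; apply/imfsetP.
  by exists (nth [::] g j); rewrite //= mem_nth.
exists (map f ab.1), (map f ab.2); split.
- by apply: fF => j ja; rewrite mem_cat ja.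
- by apply: fF => j ja; rewrite mem_cat ja orbT.
have sumE a (k : 'I_6) : ((\sum_(h <- map f a) h)%MM : 'X_{1..6}) k =
    sumn [seq nat_of_bool (nth false (nth [::] g j) k) | j <- a].
  rewrite mnm_sumE big_map sumnE big_map.
  by apply: eq_bigr => j _; rewrite mnmE.
apply/mnmP => k; have := e k; rewrite mem_iota ltn_ord => /(_ isT)/eqP.
by rewrite !mnmDE !sumE !mnm1E.
Qed.

Lemma check_modelP (K : fieldType) M : check_model M ->
  type3_cremona K (monos 6 (model_set M)).
Proof.
rewrite /check_model; move: (model_set M) => g.
case/and5P => ug /allP gT /eqP g6 t3 /andP[/allP can /allP cert].
have g_6 := size_triples gT; have pg := perm_monos ug g_6.
split; last exact/type3P.
- apply: (@cremona_same_class _ _ _ _ ord0).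
  + by rewrite /= (perm_size pg) size_map.
  + move=> _ /imfsetP[t /= /gT tT ->].
    move: tT; rewrite mem_triples => /andP[/eqP t6 /eqP c3].
    by rewrite mdeg_expo.
  + by move=> i; apply/check_certificateP/cert; rewrite mem_iota ltn_ord.
- by move=> _ i /imfsetP[t _ ->]; rewrite mnmE; case: nth.
- move=> i; have := can i; rewrite mem_iota ltn_ord => /(_ isT).
  rewrite -has_predC => /andP[/hasP[s sg si] /hasP[t tg /= ti]]; split.
    by exists (expo 6 s); [apply/imfsetP; exists s | rewrite mnmE si].
  by exists (expo 6 t); [apply/imfsetP; exists t | rewrite mnmE (negbTE ti)].
Qed.

(** * Computations and classification *)

Lemma all_check_model : all check_model models.
Proof. by vm_compute. Qed.

Lemma reps_triples i : {subset nth [::] reps i <= triples}.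
Proof.
have [i_lt|i_ge] := ltnP i (size models); last first.
  by rewrite nth_default // size_map.
rewrite (nth_map ([::], [::])) //.
by have /and3P[_ /allP] := all_nthP ([::], [::]) all_check_model i i_lt.
Qed.

(** The [let] shares one orbit of 720 words among all tests against the i-th model. *)
Definition separated : bool :=
  all (fun i => let C := codes (nth [::] reps i) in
    all (fun j => (i == j) || (code (nth [::] reps j) \notin C)) (iota 0 10))
  (iota 0 10).

Lemma separated_reps : separated.
Proof. by vm_compute. Qed.

(** This runs through all 38760 six-element subsets of the 20 triples, with the ten orbits as listed
    words and the kernels of the gradings as upper bounds. *)
Lemma covered_triples :
  covered (fun g => ~~ type3b g) 6 triples [::]
    (flatten (map codes reps)) obstructions.
Proof. by vm_compute. Qed.

Lemma type3_cremona_rep (K : fieldType) F : type3_cremona K F ->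
  exists2 i, i < 10 & monomial_iso (monos 6 (nth [::] reps i)) F.
Proof.
move=> [CF F1 _ F3]; have [cF dF _] := CF.
have FE := monos_triples F1 dF; set g := [seq _ <- _ | _] in FE.
have gT : {subset g <= triples} by move=> t; rewrite mem_filter => /andP[].
have ug : uniq g by rewrite filter_uniq ?triples_uniq.
have g6 : size g = 6.
  have := perm_size (perm_monos ug (size_triples gT)).
  by rewrite FE size_map => <-.
rewrite -FE in CF F3 *.
(* [g] inherits the order of [triples], so its code selects it as a list and not only as a set. *)
have gE : mask (code g) triples = g.
  rewrite -filter_mask; apply: eq_in_filter => t tT.
  by rewrite mem_filter tT andbT.
have cg : count id (code g) = 6.
  by rewrite -g6 -[in RHS]gE size_mask // size_map.
have := coveredP covered_triples (size_map _ _ : size (code g) = _) cg.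
rewrite gE => /or3P[].
- case/flattenP => _ /mapP[h /(nthP [::])[i i10 <-] ->] gh.
  by exists i => //; apply/codesP => //; apply: reps_triples.
(* A grading that kills [g] but not all triples contradicts [cremona_grading]. *)
- case/hasP => o; rewrite mem_filter => /andP[/negP not_o /mapP[kw _ oE]] go.
  case: not_o; rewrite oE; apply: cremona_grading CF _ => //.
  by move: go; rewrite oE -map_mask gE all_map.
(* The accumulator of the search lists the subset in reverse order; being of type 3 depends on the
   set only. *)
- rewrite -[catrev _ _]/(rev g) => /negP[].
  apply/type3P; rewrite ?rev_uniq ?size_rev //.
    by move=> t; rewrite mem_rev; apply: gT.
  by rewrite (@eq_monos _ _ g) // => t; rewrite mem_rev.
Qed.

Theorem proposition4p7 (K : fieldType) :
  exists G : 'I_10 -> {fset 'X_{1..6}},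
    [/\ forall i, type3_cremona K (G i),
        forall i j, monomial_iso (G i) (G j) -> i = j &
        forall F, type3_cremona K F -> exists i, monomial_iso (G i) F].
Proof.
exists (fun i : 'I_10 => monos 6 (nth [::] reps i)); split.
- move=> i; rewrite (nth_map ([::], [::])) //; apply: check_modelP.
  exact: (all_nthP ([::], [::]) all_check_model).
- move=> i j /codesP ij; have /allP/(_ i) := separated_reps.
  rewrite mem_iota ltn_ord => /(_ isT)/allP/(_ j).
  rewrite mem_iota ltn_ord ij ?orbF => [/(_ isT)/eqP/val_inj //||];
    exact: reps_triples.
- move=> F /type3_cremona_rep[i i10 iF]; by exists (Ordinal i10).
Qed.
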